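(* Let $N\ge 2$ be even and consider $\mathbb{R}^{2N}$ with coordinates $(q_1,\dots,q_N,p_1,\dots,p_N)$, the Poisson tensors $J_1,J_2$ given by the block matrices $$J_1=\begin{pmatrix}0&I\\-I&0\end{pmatrix},\qquad J_2=\begin{pmatrix}A&B\\-B&C\end{pmatrix},$$ where $I$ is the $N\times N$ identity matrix, $A$ is the skew-symmetric $N\times N$ matrix with $A_{ij}=1=-A_{ji}$ for $i<j$, $B=\operatorname{diag}(-p_1,\dots,-p_N)$, and $C$ is the skew-symmetric $N\times N$ matrix whose only non-zero entries are $C_{i,i+1}=-C_{i+1,i}=e^{q_i-q_{i+1}}$, $i=1,\dots,N-1$. Let $\mathcal{R}=J_2J_1^{-1}$ and $J_4=\mathcal{R}^2J_2$. Let $\psi:\mathbb{R}^{2N}\to\mathbb{R}^{2N}$ be the involution $\psi(q,p)=(q,-p)$, whose fixed point set $\{p=0\}$ is identified with $V_q=\mathbb{R}^N$ with coordinates $(q_1,\dots,q_N)$, and let $\iota:V_q\hookrightarrow\mathbb{R}^{2N}$, $\iota(q)=(q,0)$. Then $\psi$ is a Poisson automorphism of both $J_2$ and $J_4$, and the Poisson brackets which $V_q$ inherits from $J_2$ and $J_4$ as the fixed point set of $\psi$ are $w_2$ and $w_3$ respectively, where $w_2$ and $w_3$ are the skew-symmetric brackets on $V_q$ determined for all $1\le i<j\le N$ by $$\{q_i,q_j\}_{w_2}=1,$$ $$\{q_i,q_j\}_{w_3}=e^{q_{i-1}-q_i}+(1-\delta_{i+1,j})\,e^{q_i-q_{i+1}}+e^{q_{j-1}-q_j}+e^{q_j-q_{j+1}},$$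 where $\delta$ is the Kronecker delta and any exponential term involving $q_0$ or $q_{N+1}$ is omitted. That is, for all smooth $\psi$-invariant functions $F_1,F_2$ on $\mathbb{R}^{2N}$, $$\iota^*\{F_1,F_2\}_{J_2}=\{\iota^*F_1,\iota^*F_2\}_{w_2},\qquad \iota^*\{F_1,F_2\}_{J_4}=\{\iota^*F_1,\iota^*F_2\}_{w_3}.$$
   Context: A Poisson tensor $J$ on $\mathbb{R}^{2N}$ is given by its matrix in the coordinates $(x_1,\dots,x_{2N})=(q_1,\dots,q_N,p_1,\dots,p_N)$: $\{F,H\}_J=\sum_{k,l}J_{kl}\,\frac{\partial F}{\partial x_k}\frac{\partial H}{\partial x_l}$. The products $J_2J_1^{-1}$ and $\mathcal{R}^2J_2$ are matrix products. $J_1$ is the standard symplectic bracket and $J_2$ is the Das–Okubo bracket of the Toda lattice; $J_i=\mathcal{R}^{i-1}J_1$ are the higher Toda Poisson tensors (so $J_4=\mathcal{R}^3J_1=\mathcal{R}^2J_2$). A diffeomorphism $\psi$ is a Poisson automorphism of $J$ if $\{F\circ\psi,H\circ\psi\}_J=\{F,H\}_J\circ\psi$ for all smooth $F,H$. Poisson involution theorem (known): if $\psi:M\to M$ is a Poisson involution of a Poisson manifold $(M,\{\cdot,\cdot\})$ with fixed point set $\iota:Q\hookrightarrow M$, then $Q$ carries a unique Poisson bracket $\{\cdot,\cdot\}_Q$ with $\iota^*\{F_1,F_2\}=\{\iota^*F_1,\iota^*F_2\}_Q$ for all $\psi$-invariant $F_1,F_2\in C^\infty(M)$; this is the bracket that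 $Q$ ''inherits''. *)

(* Defs.v *)
(* Mathematical Components with MathComp-Analysis. *)
From HB Require Import structures.
From mathcomp Require Import all_boot all_order all_algebra.
From mathcomp Require Import all_classical all_reals all_analysis.
Set Implicit Arguments.
Unset Strict Implicit.
Unset Printing Implicit Defensive.
Import Order.TTheory GRing.Theory Num.Theory.
Import numFieldNormedType.Exports.
Local Open Scope classical_set_scope.
Local Open Scope ring_scope.

Definition pderiv (R : realType) (n : nat) (i : 'I_n) (F : 'rV[R]_n -> R) :
    'rV[R]_n -> R :=
  'D_(delta_mx 0 i) F.

Fixpoint is_Ck (R : realType) (n k : nat) (F : 'rV[R]_n -> R) : Prop :=
  if k is k'.+1 then
    continuous F /\
    forall i : 'I_n,
      (forall x, derivable F x (delta_mx 0 i)) /\ is_Ck k' (pderiv i F)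
  else continuous F.

Definition smooth (R : realType) (n : nat) (F : 'rV[R]_n -> R) : Prop :=
  forall k, is_Ck k F.

Definition smooth_map (R : realType) (m n : nat)
    (f : 'rV[R]_m -> 'rV[R]_n) : Prop :=
  forall i : 'I_n, smooth (fun x => f x 0 i).

Definition diffeomorphism (R : realType) (m n : nat)
    (f : 'rV[R]_m -> 'rV[R]_n) : Prop :=
  exists g : 'rV[R]_n -> 'rV[R]_m,
    [/\ smooth_map f, smooth_map g, cancel f g & cancel g f].

Definition bracket (R : realType) (n : nat) (J : 'rV[R]_n -> 'M[R]_n)
    (F H : 'rV[R]_n -> R) : 'rV[R]_n -> R :=
  fun x => \sum_k \sum_l J x k l * pderiv k F x * pderiv l H x.

(* The values of b outside smooth functions are irrelevant. *)
Record is_poisson_bracket (R : realType) (n : nat)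
    (b : ('rV[R]_n -> R) -> ('rV[R]_n -> R) -> 'rV[R]_n -> R) : Prop := {
  poisson_smooth : forall F G, smooth F -> smooth G -> smooth (b F G);
  poisson_skew : forall F G, smooth F -> smooth G ->
    forall x, b F G x = - b G F x;
  poisson_linear : forall (a : R) F G H, smooth F -> smooth G -> smooth H ->
    forall x, b (fun y => a * F y + G y) H x = a * b F H x + b G H x;
  poisson_leibniz : forall F G H, smooth F -> smooth G -> smooth H ->
    forall x, b (fun y => F y * G y) H x = F x * b G H x + b F H x * G x;
  poisson_jacobi : forall F G H, smooth F -> smooth G -> smooth H ->
    forall x, b F (b G H) x + b G (b H F) x + b H (b F G) x = 0
}.

Definition poisson_automorphism (R : realType) (n : nat)
    (J : 'rV[R]_n -> 'M[R]_n) (psi : 'rV[R]_n -> 'rV[R]_n) : Prop :=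
  diffeomorphism psi /\
  forall F H, smooth F -> smooth H ->
    bracket J (F \o psi) (H \o psi) = bracket J F H \o psi.

(* The smooth left inverse makes iota an embedding (injective, immersive and
   a homeomorphism onto its image). *)
Definition fixed_point_embedding (R : realType) (m n : nat)
    (psi : 'rV[R]_n -> 'rV[R]_n) (iota : 'rV[R]_m -> 'rV[R]_n) : Prop :=
  [/\ smooth_map iota,
      exists r : 'rV[R]_n -> 'rV[R]_m, smooth_map r /\ cancel iota r
    & range iota = [set x | psi x = x]].

(* The defining property of the bracket on the fixed point set. *)
Definition restricts_to (R : realType) (m n : nat)
    (J : 'rV[R]_n -> 'M[R]_n) (psi : 'rV[R]_n -> 'rV[R]_n)
    (iota : 'rV[R]_m -> 'rV[R]_n)
    (b : ('rV[R]_m -> R) -> ('rV[R]_m -> R) -> 'rV[R]_m -> R) : Prop :=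
  forall F1 F2, smooth F1 -> smooth F2 ->
    F1 \o psi = F1 -> F2 \o psi = F2 ->
    bracket J F1 F2 \o iota = b (F1 \o iota) (F2 \o iota).

(* b is the unique Poisson bracket inherited from J by the fixed point set of
   psi, parametrized by iota. *)
Definition inherited_bracket (R : realType) (m n : nat)
    (J : 'rV[R]_n -> 'M[R]_n) (psi : 'rV[R]_n -> 'rV[R]_n)
    (iota : 'rV[R]_m -> 'rV[R]_n)
    (b : ('rV[R]_m -> R) -> ('rV[R]_m -> R) -> 'rV[R]_m -> R) : Prop :=
  [/\ fixed_point_embedding psi iota,
      is_poisson_bracket b,
      restricts_to J psi iota b
    & forall b', is_poisson_bracket b' -> restricts_to J psi iota b' ->
        forall f g, smooth f -> smooth g -> b' f g = b f g].

(* The skew-symmetric matrix with prescribed entries above the diagonal. *)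
Definition skew_mx (R : realType) (N : nat) (u : 'I_N -> 'I_N -> R) : 'M[R]_N :=
  \matrix_(i, j) (if (i < j)%N then u i j
                  else if (j < i)%N then - u j i else 0).

(* Points of R^(2N) are row vectors (q, p) : 'rV_(N + N), with q the left half
   and p the right half. Indices start at 0. *)

Definition toda_A (R : realType) (N : nat) : 'M[R]_N := skew_mx (fun _ _ => 1).

Definition toda_B (R : realType) (N : nat) (p : 'rV[R]_N) : 'M[R]_N :=
  diag_mx (- p).

Definition toda_C (R : realType) (N : nat) (q : 'rV[R]_N) : 'M[R]_N :=
  skew_mx (fun i j => if j == i.+1 :> nat then expR (q 0 i - q 0 j) else 0).

Definition toda_J1 (R : realType) (N : nat) : 'M[R]_(N + N) :=
  block_mx 0 1%:M (- 1%:M) 0.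

Definition toda_J2 (R : realType) (N : nat) (x : 'rV[R]_(N + N)) :
    'M[R]_(N + N) :=
  block_mx (toda_A R N) (toda_B (rsubmx x))
           (- toda_B (rsubmx x)) (toda_C (lsubmx x)).

Definition toda_recursion (R : realType) (N : nat) (x : 'rV[R]_(N + N)) :
    'M[R]_(N + N) :=
  toda_J2 x *m invmx (toda_J1 R N).

Definition toda_J4 (R : realType) (N : nat) (x : 'rV[R]_(N + N)) :
    'M[R]_(N + N) :=
  toda_recursion x *m toda_recursion x *m toda_J2 x.

Definition flip_p (R : realType) (N : nat) (x : 'rV[R]_(N + N)) :
    'rV[R]_(N + N) :=
  row_mx (lsubmx x) (- rsubmx x).

Definition zero_section (R : realType) (N : nat) (q : 'rV[R]_N) :
    'rV[R]_(N + N) :=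
  row_mx q 0.

(* e^(q_(i-1) - q_i) and e^(q_i - q_(i+1)): each sum has at most one term, and
   is empty (hence 0) when the neighbouring index is out of range. *)
Definition exp_prev (R : realType) (N : nat) (q : 'rV[R]_N) (i : 'I_N) : R :=
  \sum_(k < N | k.+1 == i :> nat) expR (q 0 k - q 0 i).

Definition exp_next (R : realType) (N : nat) (q : 'rV[R]_N) (i : 'I_N) : R :=
  \sum_(k < N | i.+1 == k :> nat) expR (q 0 i - q 0 k).

Definition w2 (R : realType) (N : nat) (q : 'rV[R]_N) : 'M[R]_N :=
  skew_mx (fun _ _ => 1).

Definition w3 (R : realType) (N : nat) (q : 'rV[R]_N) : 'M[R]_N :=
  skew_mx (fun i j =>
    exp_prev q i + (1 - (i.+1 == j :> nat)%:R) * exp_next q i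
    + exp_prev q j + exp_next q j).

(* Main.v *)
Require Import Defs.
From mathcomp Require Import all_boot all_order all_algebra.
From mathcomp Require Import all_classical all_reals all_analysis.
From mathcomp Require Import ring zify.
Set Implicit Arguments.
Unset Strict Implicit.
Unset Printing Implicit Defensive.
Import Order.TTheory GRing.Theory Num.Theory.
Import numFieldNormedType.Exports.
Local Open Scope classical_set_scope.
Local Open Scope ring_scope.

(* Writing S for the Jacobian matrix of psi, one has S J_2 S = J_2 o psi and
   S J_1 S = - J_1, hence S R S = - R o psi and S J_4 S = J_4 o psi.  The
   p-derivatives of invariant functions vanish on p = 0, so there the brackets
   reduce to the upper left blocks of J_2 and J_4, which are A and - A C A.

   The Jacobi identity for w_3 = - A C A = A C A^T is checked directly: with the
   commuting derivations D_d = \sum_l A_ld d/dq_l one has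
   D_d C_ab = (d_da + d_db) C_ab, and the Jacobiator becomes the cyclic sum of
   (C_ca + C_cb) C_ab, which vanishes by skew-symmetry.  Uniqueness
   holds because f(q) extends to an invariant function of (q, p). *)

(** * Directional derivatives and smooth functions *)

(** On the line through x in direction v the two difference quotients coincide at every parameter t,
    so one-variable tools such as the mean value theorem become available. *)
Lemma is_derive_line {R : realType} {V : normedModType R} (F : V -> R)
    (x v : V) (t : R) : derivable F (t *: v + x) v ->
  is_derive t 1 (fun h : R => F (h *: v + x)) ('D_v F (t *: v + x)).
Proof.
have E : (fun h : R => h^-1 *:
      (((fun h => F (h *: v + x)) \o shift t) (h *: 1) - F (t *: v + x))) =
    (fun h : R => h^-1 *: ((F \o shift (t *: v + x)) (h *: v) - F (t *: v + x))).
  by apply/funext => h /=; rewrite [h%:A]mulr1 scalerDl addrA.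
by move=> dF; split; rewrite /derivable /derive E.
Qed.

Lemma derive_line {R : realType} {V : normedModType R} (F : V -> R)
    (x v : V) :
  'D_v F x = 'D_1 (fun h : R => F (h *: v + x)) 0.
Proof.
rewrite /derive; set f := fun h => _; set g := fun h => _.
suff -> : f = g by [].
by apply/funext => h; rewrite /f /g /= addr0 scale0r add0r [h%:A]mulr1.
Qed.

(** Only a directional derivative of F is assumed, not differentiability: restriction to the line x
    + hv reduces the claim to the one-variable chain rule. *)
Lemma is_derive_compR {R : realType} {V : normedModType R} (g : R -> R)
    (F : V -> R) (x v : V) (df dg : R) :
  is_derive x v F df -> is_derive (F x) 1 g dg ->
  is_derive x v (g \o F) (dg * df).
Proof.
move=> [dF eF] [dG eG]; have Fx : F (0 *: v + x) = F x by rewrite scale0r add0r.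
have dF1 := (derivable1P _ _ _).1 dF.
have dG1 : derivable g (F (0 *: v + x)) 1 by rewrite Fx; exact: dG.
have dGF : derivable (fun h : R => (g \o F) (h *: v + x)) 0 1.
  apply/derivable1_diffP.
  apply: (@differentiable_comp _ _ _ _ (fun h : R => F (h *: v + x)) g).
    exact: (derivable1_diffP _ _).1 dF1.
  exact: (derivable1_diffP _ _).1 dG1.
split; first exact: (derivable1P _ _ _).2 dGF.
rewrite derive_line -derive1E.
have -> := derive1_comp dF1 dG1.
by rewrite !derive1E Fx eG -derive_line eF.
Qed.

(** Follows from the chain rule for h |-> hc followed by the restriction of F to the line; this also
    covers c = 0 without a case distinction. *)
Lemma is_derive_scale {R : realType} {V : normedModType R} (F : V -> R)
    (x v : V) (c : R) : derivable F x v ->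
  is_derive x (c *: v) F (c * 'D_v F x).
Proof.
move=> dF; pose L := fun h : R => F (h *: v + x).
have dL : derivable L 0 1 := (derivable1P _ _ _).1 dF.
have dmul : is_derive (0 : R) 1 (( *%R^~ c) : R -> R) c.
  have := is_deriveM (is_derive_id (0 : R) 1) (is_derive_cst c (0 : R) 1).
  by rewrite scaler0 add0r [_ *: _]mulr1.
have g0 : (0 * c : R) = 0 by rewrite mul0r.
have [dLc eLc] : is_derive (0 : R) 1 (L \o ( *%R^~ c)) ('D_v F x * c).
  have dL0 : is_derive ((fun h : R => h * c) 0) 1 L ('D_v F x).
    by rewrite /= g0 (derive_line F); exact: derivableP dL.
  exact: (is_derive_compR dmul dL0).
have E : (fun h : R => F (h *: (c *: v) + x)) = L \o ( *%R^~ c).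
  by apply/funext => h /=; rewrite /L scalerA.
split; first by apply/derivable1P; rewrite E.
by rewrite derive_line E eLc mulrC.
Qed.

(** * Closure properties of smooth functions *)

Section smooth_functions.
Context {R : realType} {n : nat}.
Implicit Types (F G : 'rV[R]_n -> R) (i j : 'I_n) (k : nat).

Lemma is_CkW k F : is_Ck k.+1 F -> is_Ck k F.
Proof.
elim: k F => [|k IH] F [cF dF] //; split=> // i.
by have [dFi CF] := dF i; split=> //; exact: IH.
Qed.

Lemma smooth_continuous F : smooth F -> continuous F.
Proof. exact: (fun sF => sF 0). Qed.

Lemma smooth_derivable F i x : smooth F -> derivable F x (delta_mx 0 i).
Proof. by move=> /(_ 1) [_ /(_ i)[]]. Qed.

Lemma smooth_pderiv F i : smooth F -> smooth (pderiv i F).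
Proof. by move=> sF k; have [_ /(_ i)[]] := sF k.+1. Qed.

(** Smoothness of an explicit function is reduced to finding a family that contains it and is stable
    under partial derivatives. *)
Lemma smooth_coind (P : ('rV[R]_n -> R) -> Prop) :
  (forall F, P F -> continuous F /\
    forall i, (forall x, derivable F x (delta_mx 0 i)) /\ P (pderiv i F)) ->
  forall F, P F -> smooth F.
Proof.
move=> step F PF k; elim: k F PF => [|k IH] F /step[cF dF] //.
by split=> // i; have [dFi PFi] := dF i; split=> //; exact: IH.
Qed.

Lemma pderiv_cst i (c : R) : pderiv i (fun=> c) = fun=> 0 :> R.
Proof. by apply/funext => x; exact: derive_cst. Qed.

Lemma pderivD i F G : (forall x, derivable F x (delta_mx 0 i)) ->
  (forall x, derivable G x (delta_mx 0 i)) ->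
  pderiv i (fun x => F x + G x) = fun x => pderiv i F x + pderiv i G x.
Proof. by move=> dF dG; apply/funext => x; exact: deriveD. Qed.

Lemma pderivM i F G : (forall x, derivable F x (delta_mx 0 i)) ->
  (forall x, derivable G x (delta_mx 0 i)) ->
  pderiv i (fun x => F x * G x) =
  fun x => pderiv i F x * G x + F x * pderiv i G x.
Proof.
move=> dF dG; apply/funext => x; rewrite addrC [X in _ + X]mulrC.
exact: deriveM.
Qed.

Lemma is_CkD k F G : is_Ck k F -> is_Ck k G -> is_Ck k (fun x => F x + G x).
Proof.
elim: k F G => [|k IH] F G => [cF cG x|[cF dF] [cG dG]].
  exact: (cvgD (cF x) (cG x)).
split=> [x|i]; first exact: (cvgD (cF x) (cG x)).
have [dFi CF] := dF i; have [dGi CG] := dG i.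
split=> [x|]; first exact: derivableD.
by rewrite pderivD //; exact: IH.
Qed.

Lemma is_CkM k F G : is_Ck k F -> is_Ck k G -> is_Ck k (fun x => F x * G x).
Proof.
elim: k F G => [|k IH] F G => [cF cG x|CkF CkG].
  exact: (cvgM (cF x) (cG x)).
have [[cF dF] [cG dG]] := (CkF, CkG).
split=> [x|i]; first exact: (cvgM (cF x) (cG x)).
have [dFi CF] := dF i; have [dGi CG] := dG i.
split=> [x|]; first exact: derivableM.
(* The Leibniz rule leaves one factor undifferentiated, of class k+1, which is weakened to class
   k. *)
by rewrite pderivM //; apply: is_CkD; apply: IH => //; exact: is_CkW.
Qed.

Lemma smoothD F G : smooth F -> smooth G -> smooth (fun x => F x + G x).
Proof. by move=> sF sG k; exact: is_CkD. Qed.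

Lemma smoothM F G : smooth F -> smooth G -> smooth (fun x => F x * G x).
Proof. by move=> sF sG k; exact: is_CkM. Qed.

Lemma smooth_cst (c : R) : smooth (fun _ : 'rV[R]_n => c).
Proof.
apply: (@smooth_coind (fun F => exists c, F = fun=> c)); last by exists c.
move=> _ [{}c ->]; split=> [x|i]; first exact: cst_continuous.
split=> [x|]; first exact: derivable_cst.
by exists 0; exact: pderiv_cst.
Qed.

Lemma smoothZ (c : R) F : smooth F -> smooth (fun x => c * F x).
Proof. exact/smoothM/smooth_cst. Qed.

Lemma smooth_sum {I : Type} (r : seq I) (P : pred I) (F : I -> 'rV[R]_n -> R) :
  (forall a, P a -> smooth (F a)) -> smooth (fun x => \sum_(a <- r | P a) F a x).
Proof.
move=> sF; elim: r => [|a r IH].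
  by under eq_fun do rewrite big_nil; exact: smooth_cst.
under eq_fun do rewrite big_cons.
by case: (boolP (P a)) => // Pa; apply: smoothD => //; exact: sF.
Qed.

Lemma pderivZ i (c : R) F x : smooth F ->
  pderiv i (fun y => c * F y) x = c * pderiv i F x.
Proof.
move=> sF; rewrite pderivM; last first.
  by move=> y; exact: smooth_derivable.
  by move=> y; exact: derivable_cst.
by rewrite pderiv_cst mul0r add0r.
Qed.

Lemma smooth_pderivD i F G x : smooth F -> smooth G ->
  pderiv i (fun y => F y + G y) x = pderiv i F x + pderiv i G x.
Proof. by move=> sF sG; rewrite pderivD // => y; exact: smooth_derivable. Qed.

Lemma smooth_pderivM i F G x : smooth F -> smooth G ->
  pderiv i (fun y => F y * G y) x = pderiv i F x * G x + F x * pderiv i G x.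
Proof. by move=> sF sG; rewrite pderivM // => y; exact: smooth_derivable. Qed.

Lemma pderiv_sum {I : Type} (r : seq I) (F : I -> 'rV[R]_n -> R) i x :
  (forall a, smooth (F a)) ->
  pderiv i (fun y => \sum_(a <- r) F a y) x = \sum_(a <- r) pderiv i (F a) x.
Proof.
move=> sF; elim: r => [|a r IH].
  by rewrite big_nil; under eq_fun do rewrite big_nil; rewrite pderiv_cst.
rewrite big_cons -IH -smooth_pderivD //; last exact: smooth_sum.
by under eq_fun do rewrite big_cons.
Qed.

Lemma is_derive_coord i j x :
  is_derive x (delta_mx 0 i) (fun y : 'rV[R]_n => y 0 j) (i == j)%:R.
Proof.
split; first exact/diff_derivable/differentiable_coord.
(* The difference quotient of a coordinate is constant for h <> 0. *)
rewrite /derive; apply: cvg_lim => //; apply: (@cvg_near_cst).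
near=> h; rewrite /= !mxE addrK eqxx /= [j == i]eq_sym.
rewrite scalerA mulVf ?scale1r //.
by near: h; exact: nbhs_dnbhs_neq.
Unshelve. all: by end_near. Qed.

Lemma smooth_coord j : smooth (fun x : 'rV[R]_n => x 0 j).
Proof.
case=> [|k]; first exact: coord_continuous.
split=> [|i]; first exact: coord_continuous.
have dj x := is_derive_coord i j x.
split=> [x|]; first exact: (@ex_derive _ _ _ _ _ _ _ (dj x)).
rewrite (_ : pderiv _ _ = fun=> (i == j)%:R); first exact: smooth_cst.
by apply/funext => x; exact: (@derive_val _ _ _ _ _ _ _ (dj x)).
Qed.

Lemma is_derive_exp_sub i j l x :
  is_derive x (delta_mx 0 l) (fun y : 'rV[R]_n => expR (y 0 i - y 0 j))
    (((l == i)%:R - (l == j)%:R) * expR (x 0 i - x 0 j)).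
Proof.
have D := is_deriveB (is_derive_coord l i x) (is_derive_coord l j x).
have := is_derive_compR D (is_derive_expR (x 0 i - x 0 j)).
by rewrite mulrC.
Qed.

Lemma smooth_exp_sub i j : smooth (fun x : 'rV[R]_n => expR (x 0 i - x 0 j)).
Proof.
(* The multiples of the exponential form a stable family: each partial derivative multiplies the
   coefficient by an integer constant. *)
apply: (@smooth_coind
  (fun F => exists c, F = fun x => c * expR (x 0 i - x 0 j))); last first.
  by exists 1; under [RHS]eq_fun do rewrite mul1r.
have cexp : continuous (fun x : 'rV[R]_n => expR (x 0 i - x 0 j)).
  move=> x; apply: (@continuous_comp _ _ _ (fun y : 'rV[R]_n => y 0 i - y 0 j)).
    exact: (cvgB (@coord_continuous R _ _ 0 i x) (@coord_continuous R _ _ 0 j x)).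
  exact: continuous_expR.
move=> _ [c ->]; split=> [x|l].
  exact: (cvgM (cvg_cst c) (cexp x)).
split=> [x|].
  apply: derivableM; first exact: derivable_cst.
  exact: (@ex_derive _ _ _ _ _ _ _ (is_derive_exp_sub i j l x)).
exists (c * ((l == i)%:R - (l == j)%:R)); rewrite pderivM; first last.
- by move=> x; exact: (@ex_derive _ _ _ _ _ _ _ (is_derive_exp_sub i j l x)).
- by move=> x; exact: derivable_cst.
apply/funext => x; rewrite pderiv_cst mul0r add0r -mulrA; congr (_ * _).
exact: (@derive_val _ _ _ _ _ _ _ (is_derive_exp_sub i j l x)).
Qed.

End smooth_functions.

(** * Symmetry of second derivatives *)

Lemma mean_value_line {R : realType} {V : normedModType R} (F : V -> R)
    (v x : V) (h : R) : (forall y, derivable F y v) -> 0 < h ->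
  exists2 t, t \in `]0, h[ & F (h *: v + x) - F x = h * 'D_v F (t *: v + x).
Proof.
move=> dF h0; have dline t := is_derive_line (dF (t *: v + x)).
have [|t th E] := MVT h0 (fun t _ => dline t).
  apply: derivable_within_continuous => t _.
  exact: (@ex_derive _ _ _ _ _ _ _ (dline t)).
by exists t => //; move: E; rewrite scale0r add0r subr0 mulrC.
Qed.

(** The mean value theorem is applied along u to y |-> F(hv + y) - F(y), then along v to the
    derivative of F in direction u. *)
Lemma mean_value_square {R : realType} {V : normedModType R} (F : V -> R)
    (u v x : V) (h : R) : (forall y, derivable F y u) ->
  (forall y, derivable ('D_u F) y v) -> 0 < h ->
  exists st : R * R, [/\ st.1 \in `]0, h[, st.2 \in `]0, h[ &
    F (h *: u + (h *: v + x)) - F (h *: u + x) - F (h *: v + x) + F x =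
    h * h * 'D_v ('D_u F) (st.1 *: u + st.2 *: v + x)].
Proof.
move=> dF dDF h0.
have dFh y : is_derive y u (fun y => F (h *: v + y)) ('D_u F (h *: v + y)).
  have E : (fun k : R => k^-1 *:
      (((fun y => F (h *: v + y)) \o shift y) (k *: u) - F (h *: v + y))) =
    (fun k : R => k^-1 *: ((F \o shift (h *: v + y)) (k *: u) - F (h *: v + y))).
    by apply/funext => k /=; rewrite addrCA.
  by split; rewrite /derivable /derive E //; exact: dF.
have dG y := is_deriveB (dFh y) (derivableP (dF y)).
have [s sh Es] := mean_value_line x
  (fun y => @ex_derive _ _ _ _ _ _ _ (dG y)) h0.
have [t th Et] := mean_value_line (s *: u + x) dDF h0.
exists (s, t); split; [exact: sh|exact: th|].
have -> : s *: u + t *: v + x = t *: v + (s *: u + x).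
  by rewrite addrA (addrC (t *: v)).
rewrite -mulrA -Et -(@derive_val _ _ _ _ _ _ _ (dG (s *: u + x))).
rewrite addrAC -Es /= -![(_ - _ : _ -> _) _]/(_ - _) (addrCA (h *: v)).
by ring.
Qed.

(** The second difference over the parallelogram spanned by hu and hv is symmetric in u and v. It
    equals h^2 times either mixed derivative, each at a point near x, and continuity at x
    concludes. *)
Lemma derive_comm {R : realType} {V : normedModType R} (F : V -> R)
    (u v x : V) :
  (forall y, derivable F y u) -> (forall y, derivable F y v) ->
  (forall y, derivable ('D_u F) y v) -> (forall y, derivable ('D_v F) y u) ->
  {for x, continuous ('D_v ('D_u F))} -> {for x, continuous ('D_u ('D_v F))} ->
  'D_v ('D_u F) x = 'D_u ('D_v F) x.
Proof.
move=> dFu dFv dFuv dFvu cuv cvu.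
apply/eqP; rewrite -subr_eq0 -normr_le0; apply/ler_addgt0Pl => e e0.
rewrite addr0.
have e2 : 0 < e / 2 by rewrite divr_gt0.
pose P y := `|'D_v ('D_u F) x - 'D_v ('D_u F) y| < e / 2 /\
  `|'D_u ('D_v F) x - 'D_u ('D_v F) y| < e / 2.
have Px : \forall y \near x, P y.
  apply: filterI.
    by move/cvgrPdist_lt : cuv; apply.
  by move/cvgrPdist_lt : cvu; apply.
(* The estimate P near x is pulled back to the parameters (s, t); d bounds a square around the
   origin on which it holds. *)
pose f (p : R * R) := p.1 *: u + p.2 *: v + x.
have cf : {for (0, 0), continuous f}.
  apply: cvgD; last exact: cvg_cst.
  by apply: cvgD; apply: cvgZr_tmp; [exact: cvg_fst|exact: cvg_snd].
have f0 : f (0, 0) = x by rewrite /f /= !scale0r !add0r.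
rewrite -f0 in Px; have [[A B] /= [A0 B0] AB] := cf _ Px.
have [d d0 dAB] : exists2 d : R, 0 < d & forall s, `|s| < d -> A s /\ B s.
  have : \forall s \near (0 : R), (A `&` B) s by exact: filterI A0 B0.
  move/nbhs_norm0P => [d /= d0 dAB].
  by exists d => // s /dAB.
have d2 : 0 < d / 2 by rewrite divr_gt0.
have Pst s t : s \in `]0, d / 2[ -> t \in `]0, d / 2[ -> P (f (s, t)).
  rewrite !in_itv /= => /andP[s0 sd] /andP[t0 td]; apply: (AB (s, t)).
  have dd : d / 2 < d by rewrite ltr_pdivrMr// mulr2n mulrDr mulr1 ltrDl.
  by split; [have [] := dAB s|have [] := dAB t];
    rewrite // gtr0_norm // (lt_trans _ dd).
have [[s t] /= [sd td E1]] := mean_value_square x dFu dFuv d2.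
have [[t' s'] /= [td' sd' E2]] := mean_value_square x dFv dFvu d2.
rewrite (addrC (t' *: v)) in E2.
have dd : d / 2 * (d / 2) != 0 by rewrite mulf_neq0 // gt_eqF.
(* Both sides are the same second difference with side h = d/2; cancelling h^2 equates the mixed
   derivatives at the two intermediate points. *)
have /(mulfI dd) E : d / 2 * (d / 2) * 'D_v ('D_u F) (s *: u + t *: v + x) =
    d / 2 * (d / 2) * 'D_u ('D_v F) (s' *: u + t' *: v + x).
  apply: (etrans (esym E1)); apply: (etrans _ E2).
  rewrite (addrCA (d / 2 *: u)); congr (_ + _); exact: addrAC.
have [P1 _] := Pst _ _ sd td; have [_ P2] := Pst _ _ sd' td'.
rewrite /f [_.1]/= [_.2]/= in P1 P2.
rewrite -E distrC in P2.
rewrite (splitr e).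
apply: le_trans (ler_distD ('D_v ('D_u F) (s *: u + t *: v + x)) _ _) _.
by apply: lerD; apply: ltW; [exact: P1|exact: P2].
Qed.

Lemma pderiv_comm {R : realType} {n : nat} (F : 'rV[R]_n -> R) (i j : 'I_n) :
  smooth F -> pderiv i (pderiv j F) = pderiv j (pderiv i F).
Proof.
move=> sF; apply/funext => x.
by apply: derive_comm => [y|y|y|y||];
  do ?[apply: smooth_derivable|apply: smooth_continuous|apply: smooth_pderiv].
Qed.

Section monomial_substitution.
(* A linear map whose matrix is monomial: every basis vector is sent to a
   multiple of a basis vector, so that no chain rule is needed. *)
Context {R : realType} {m n : nat} (L : 'rV[R]_m -> 'rV[R]_n).
Context (c : 'I_m -> R) (s : 'I_m -> 'I_n).
Hypothesis L_linear : forall (h : R) v x, L (h *: v + x) = h *: L v + L x.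
Hypothesis L_continuous : continuous L.
Hypothesis L_basis : forall i, L (delta_mx 0 i) = c i *: delta_mx 0 (s i).

Lemma is_derive_comp_monomial (F : 'rV[R]_n -> R) i x : smooth F ->
  is_derive x (delta_mx 0 i) (F \o L) (c i * pderiv (s i) F (L x)).
Proof.
move=> sF; have D := is_derive_scale (c i) (@smooth_derivable _ _ F (s i) (L x) sF).
rewrite -L_basis in D.
have E : (fun h : R => h^-1 *:
      (((F \o L) \o shift x) (h *: delta_mx 0 i) - (F \o L) x)) =
    (fun h : R => h^-1 *:
      ((F \o shift (L x)) (h *: L (delta_mx 0 i)) - F (L x))).
  by apply/funext => h /=; rewrite L_linear.
case: D => D1 D2; split; first by rewrite /derivable E.
by rewrite /derive E.
Qed.

Lemma pderiv_comp_monomial (F : 'rV[R]_n -> R) i x : smooth F ->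
  pderiv i (F \o L) x = c i * pderiv (s i) F (L x).
Proof.
by move=> sF; exact: (@derive_val _ _ _ _ _ _ _ (is_derive_comp_monomial i x sF)).
Qed.

(** The partial derivatives of F o L are again composites of smooth functions with L, so the
    induction on k generalizes over F. *)
Lemma smooth_comp_monomial (F : 'rV[R]_n -> R) : smooth F -> smooth (F \o L).
Proof.
move=> sF k; elim: k F sF => [|k IH] F sF.
  by move=> x; apply: continuous_comp; [exact: L_continuous|exact: smooth_continuous].
split=> [x|i].
  by apply: continuous_comp; [exact: L_continuous|exact: smooth_continuous].
split=> [x|]; first exact: (@ex_derive _ _ _ _ _ _ _ (is_derive_comp_monomial i x sF)).
have -> : pderiv i (F \o L) = (fun y => c i * pderiv (s i) F y) \o L.
  by apply/funext => x; exact: pderiv_comp_monomial.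
exact/IH/smoothZ/smooth_pderiv.
Qed.

End monomial_substitution.

(** * Brackets of bivector fields *)

Lemma mulmx_trE {R : comPzRingType} {m n p : nat} (A : 'M[R]_(m, n)) (M : 'M[R]_n)
    (B : 'M[R]_(p, n)) i j :
  (A *m M *m B^T) i j = \sum_a \sum_b M a b * A i a * B j b.
Proof.
rewrite mxE exchange_big; apply: eq_bigr => b _.
rewrite !mxE mulr_suml; apply: eq_bigr => a _.
by rewrite [A i a * _]mulrC.
Qed.

(** The pointwise algebra behind the Jacobi identity: f, g, h stand for gradients, ff, gg, hh for
    Hessians, [dJ] for the derivatives of the tensor, and T for an iterated bracket. *)
Lemma jacobi_cyclic_sum {R : comPzRingType} {n : nat} (J : 'M[R]_n)
    (dJ : 'I_n -> 'M[R]_n)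
    (f g h : 'rV[R]_n) (ff gg hh : 'M[R]_n) :
  let S i j k := \sum_l J i l * dJ l j k in
  let T (f g h : 'rV[R]_n) (gg hh : 'M[R]_n) :=
    \sum_l (f *m J) 0 l * ((g *m dJ l *m h^T) 0 0
      + (gg *m J *m h^T) l 0 - (hh *m J *m g^T) l 0) in
  J^T = - J -> ff^T = ff -> gg^T = gg -> hh^T = hh ->
  (forall i j k, S i j k + S j k i + S k i j = 0) ->
  T f g h gg hh + T g h f hh ff + T h f g ff gg = 0.
Proof.
move=> S T J_skew ff_sym gg_sym hh_sym S0.
(* C collects the terms that differentiate the tensor, Q those that differentiate a gradient. *)
pose C (f g h : 'rV[R]_n) := \sum_i \sum_j \sum_k f 0 i * g 0 j * h 0 k * S i j k.
pose Q (f : 'rV[R]_n) (M : 'M[R]_n) (h : 'rV[R]_n) :=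
  (f *m J *m (M *m J *m h^T)) 0 0.
have TE u v w vv ww : T u v w vv ww = C u v w + Q u vv w - Q u ww v.
  rewrite /T; under eq_bigr do rewrite mulrDr mulrDr mulrN.
  rewrite sumrB big_split /= /Q !(mxE _ _ 0 0); congr (_ + _ - _).
  transitivity (\sum_l \sum_i \sum_j \sum_k
      u 0 i * v 0 j * w 0 k * (J i l * dJ l j k)).
    apply: eq_bigr => l _; rewrite mxE mulr_suml; apply: eq_bigr => i _.
    rewrite mulmx_trE mulr_sumr; apply: eq_bigr => j _.
    by rewrite mulr_sumr; apply: eq_bigr => k _; ring.
  rewrite exchange_big; apply: eq_bigr => i _.
  rewrite exchange_big; apply: eq_bigr => j _.
  by rewrite exchange_big; apply: eq_bigr => k _; rewrite mulr_sumr.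
(* Transposition meets J twice, so the two signs cancel. *)
have Qsym u M v : M^T = M -> Q u M v = Q v M u.
  move=> M_sym; transitivity ((u *m J *m (M *m J *m v^T))^T 0 0).
    by rewrite mxE.
  by rewrite /Q !(trmx_mul, trmxK) M_sym J_skew !(mulmxN, mulNmx) opprK !mulmxA.
(* Indices are renamed so that the three cyclic terms share the factor f_i g_j h_k, which isolates
   the cyclic sum of S. *)
have Crot u v w : C v w u = \sum_i \sum_j \sum_k u 0 i * v 0 j * w 0 k * S j k i.
  rewrite /C; under eq_bigr do rewrite exchange_big.
  rewrite exchange_big; apply: eq_bigr => i _; apply: eq_bigr => j _.
  by apply: eq_bigr => k _; ring.
have Crot2 u v w : C w u v = \sum_i \sum_j \sum_k u 0 i * v 0 j * w 0 k * S k i j.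
  rewrite /C exchange_big; apply: eq_bigr => i _ /=.
  rewrite exchange_big; apply: eq_bigr => j _; apply: eq_bigr => k _; ring.
have C0 : C f g h + C g h f + C h f g = 0.
  rewrite (Crot f) (Crot2 f) -!big_split big1 //= => i _.
  rewrite -!big_split big1 //= => j _; rewrite -!big_split big1 //= => k _.
  by rewrite -!mulrDr S0 mulr0.
(* The six Hessian terms cancel in pairs by symmetry of Q. *)
rewrite !TE -[RHS]C0 (Qsym g hh f) // (Qsym h ff g) // (Qsym h gg f) //.
by ring.
Qed.

Section brackets.
Context {R : realType} {n : nat}.
Implicit Types (J : 'rV[R]_n -> 'M[R]_n) (F G H : 'rV[R]_n -> R) (x : 'rV[R]_n).

Definition gradient F x : 'rV[R]_n := \row_k pderiv k F x.

Definition hessian F x : 'M[R]_n := \matrix_(k, l) pderiv k (pderiv l F) x.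

Definition tensor_deriv J l x : 'M[R]_n :=
  \matrix_(i, j) pderiv l (fun y => J y i j) x.

Lemma gradientE F x k : gradient F x 0 k = pderiv k F x.
Proof. exact: mxE. Qed.

Lemma hessianE F x k l : hessian F x k l = pderiv k (pderiv l F) x.
Proof. exact: mxE. Qed.

Lemma tensor_derivE J l x i j :
  tensor_deriv J l x i j = pderiv l (fun y => J y i j) x.
Proof. exact: mxE. Qed.

Lemma bracketE J F H x :
  bracket J F H x = (gradient F x *m J x *m (gradient H x)^T) 0 0.
Proof.
rewrite mulmx_trE; apply: eq_bigr => k _; apply: eq_bigr => l _.
by rewrite !gradientE.
Qed.

Lemma bracket_gradient J F H x :
  bracket J F H x = \sum_l (gradient F x *m J x) 0 l * pderiv l H x.
Proof. by rewrite bracketE mxE; apply: eq_bigr => l _; rewrite [_^T _ _]mxE gradientE. Qed.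

Lemma hessian_sym F x : smooth F -> (hessian F x)^T = hessian F x.
Proof. by move=> sF; apply/matrixP => k l; rewrite mxE !hessianE pderiv_comm. Qed.

Lemma smooth_bracket J F H : (forall k l, smooth (fun x => J x k l)) ->
  smooth F -> smooth H -> smooth (bracket J F H).
Proof.
move=> sJ sF sH; apply: smooth_sum => k _; apply: smooth_sum => l _.
by do 2?apply: smoothM => //; exact: smooth_pderiv.
Qed.

(** The minus sign comes from moving the Hessian of H to the left of the skew matrix J. *)
Lemma pderiv_bracket J F H l x : (forall i j, smooth (fun y => J y i j)) ->
  (J x)^T = - J x -> smooth F -> smooth H ->
  pderiv l (bracket J F H) x =
    (gradient F x *m (tensor_deriv J l x)
      *m (gradient H x)^T) 0 0
    + (hessian F x *m J x *m (gradient H x)^T) l 0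
    - (hessian H x *m J x *m (gradient F x)^T) l 0.
Proof.
move=> sJ J_skew sF sH.
have skewE i j : J x i j = - J x j i by have /matrixP/(_ j i) := J_skew; rewrite !mxE.
have sJF i j : smooth (fun y => J y i j * pderiv i F y).
  by apply: smoothM => //; exact: smooth_pderiv.
have sJFH i j : smooth (fun y => J y i j * pderiv i F y * pderiv j H y).
  by apply: smoothM => //; exact: smooth_pderiv.
have -> : (hessian H x *m J x *m (gradient F x)^T) l 0 =
    - \sum_i \sum_j J x i j * gradient F x 0 i * hessian H x l j.
  rewrite mulmx_trE exchange_big -sumrN; apply: eq_bigr => i _.
  rewrite -sumrN; apply: eq_bigr => j _.
  by rewrite (skewE j i) !mulNr mulrAC.
rewrite opprK !mulmx_trE -!big_split pderiv_sum => [|i]; last by apply: smooth_sum.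
apply: eq_bigr => i _; rewrite -!big_split pderiv_sum //.
apply: eq_bigr => j _; rewrite !smooth_pderivM //; try exact: smooth_pderiv.
symmetry; apply: etrans (congr1 (+%R^~ _) (esym (mulrDl _ _ _))).
congr (_ * _ * _ + _ * _ * _ + _ * _ * _); try exact: gradientE.
- exact: tensor_derivE.
- exact: hessianE.
- exact: hessianE.
Qed.

(** The last hypothesis is the Jacobi identity for coordinate functions; it suffices because the
    second derivatives cancel in the Jacobiator. *)
Lemma bracket_is_poisson J : (forall k l, smooth (fun x => J x k l)) ->
  (forall x, (J x)^T = - J x) ->
  (forall x i j k,
     \sum_l J x i l * pderiv l (fun y => J y j k) x +
     \sum_l J x j l * pderiv l (fun y => J y k i) x +
     \sum_l J x k l * pderiv l (fun y => J y i j) x = 0) ->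
  is_poisson_bracket (bracket J).
Proof.
move=> sJ J_skew J_jacobi; split.
- by move=> F G; exact: smooth_bracket.
- move=> F G _ _ x; rewrite !bracketE.
  transitivity ((gradient F x *m J x *m (gradient G x)^T)^T 0 0).
    by rewrite [RHS]mxE.
  by rewrite !trmx_mul trmxK J_skew mulNmx mulmxN mulmxA mxE.
- move=> a F G H sF sG sH x; rewrite !bracketE.
  have -> : gradient (fun y => a * F y + G y) x =
      a *: gradient F x + gradient G x.
    apply/rowP => k; rewrite gradientE smooth_pderivD ?pderivZ //.
      by rewrite [RHS]mxE [X in _ = X + _]mxE ?[X in _ = _ + X]mxE !gradientE.
    exact: smoothZ.
  by rewrite !mulmxDl -!scalemxAl !mxE.
- move=> F G H sF sG sH x; rewrite !bracketE.
  have -> : gradient (fun y => F y * G y) x =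
      F x *: gradient G x + G x *: gradient F x.
    apply/rowP => k; rewrite gradientE smooth_pderivM // addrC [_ * G x]mulrC.
    by rewrite [RHS]mxE [X in _ = X + _]mxE ?[X in _ = _ + X]mxE !gradientE.
  by rewrite !mulmxDl -!scalemxAl !mxE [G x * _]mulrC.
- move=> F G H sF sG sH x.
  have expand F' G' H' : smooth F' -> smooth G' -> smooth H' ->
      bracket J F' (bracket J G' H') x = \sum_l (gradient F' x *m J x) 0 l *
        ((gradient G' x *m tensor_deriv J l x *m (gradient H' x)^T) 0 0
        + (hessian G' x *m J x *m (gradient H' x)^T) l 0
        - (hessian H' x *m J x *m (gradient G' x)^T) l 0).
    move=> sF' sG' sH'; rewrite bracket_gradient; apply: eq_bigr => l _.
    by congr (_ * _); exact: pderiv_bracket.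
  have S0 i j k :
      \sum_l J x i l * tensor_deriv J l x j k +
      \sum_l J x j l * tensor_deriv J l x k i +
      \sum_l J x k l * tensor_deriv J l x i j = 0.
    rewrite -[RHS](J_jacobi x i j k).
    by congr (_ + _ + _); apply: eq_bigr => l _; rewrite tensor_derivE.
  apply: etrans (jacobi_cyclic_sum (gradient F x) (gradient G x) (gradient H x)
    (J_skew x) (hessian_sym x sF) (hessian_sym x sG) (hessian_sym x sH) S0).
  by congr (_ + _ + _); exact: expand.
Qed.

End brackets.

(** * The involution (q, p) |-> (q, -p) *)

Section flip.
Context {R : realType} {N : nat}.
Implicit Types (F : 'rV[R]_(N + N) -> R) (f : 'rV[R]_N -> R).

Definition flip_mx : 'M[R]_(N + N) := block_mx 1%:M 0 0 (- 1%:M).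

(** The diagonal of [flip_mx] as a function of the index, the form that monomial substitution
    takes. *)
Definition flip_sign (i : 'I_(N + N)) : R := if fintype.split i is inl _ then 1 else -1.

Lemma flip_sign_lshift (i : 'I_N) : flip_sign (lshift N i) = 1.
Proof. by rewrite /flip_sign (unsplitK (inl i)). Qed.

Lemma flip_sign_rshift (i : 'I_N) : flip_sign (rshift N i) = -1.
Proof. by rewrite /flip_sign (unsplitK (inr i)). Qed.

Lemma flip_pE (x : 'rV[R]_(N + N)) i : flip_p x 0 i = flip_sign i * x 0 i.
Proof.
case: (split_ordP i) => j ->; rewrite ?flip_sign_lshift ?flip_sign_rshift.
  by rewrite row_mxEl mxE mul1r.
by rewrite row_mxEr !mxE mulN1r.
Qed.

Lemma flip_p_mulmx (x : 'rV[R]_(N + N)) : flip_p x = x *m flip_mx.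
Proof.
rewrite -{2}(hsubmxK x) mul_row_block !mulmx0 addr0 add0r mulmx1.
by rewrite mulmxN mulmx1.
Qed.

Lemma flip_p_involutive : involutive (@flip_p R N).
Proof. by move=> x; rewrite /flip_p row_mxKl row_mxKr opprK hsubmxK. Qed.

Lemma flip_p_linear (h : R) (v x : 'rV[R]_(N + N)) :
  flip_p (h *: v + x) = h *: flip_p v + flip_p x.
Proof. by rewrite !flip_p_mulmx mulmxDl scalemxAl. Qed.

Lemma flip_p_basis (i : 'I_(N + N)) :
  flip_p (delta_mx 0 i) = flip_sign i *: delta_mx 0 i.
Proof.
apply/rowP => j; rewrite flip_pE !mxE eqxx /=.
by case: eqP => [->|]; rewrite ?mulr0.
Qed.

Lemma smooth_map_flip_p : smooth_map (@flip_p R N).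
Proof.
move=> i; under eq_fun do rewrite flip_pE.
exact/smoothZ/smooth_coord.
Qed.

Lemma gradient_flip_p F x : smooth F ->
  gradient (F \o @flip_p R N) x = gradient F (flip_p x) *m flip_mx.
Proof.
move=> sF; rewrite -flip_p_mulmx; apply/rowP => i.
rewrite flip_pE (gradientE _ x i) (gradientE F _ i).
exact: (pderiv_comp_monomial flip_p_linear flip_p_basis).
Qed.

Lemma tr_flip_mx : flip_mx^T = flip_mx.
Proof. by rewrite tr_block_mx !trmx0 linearN /= trmx1. Qed.

Lemma flip_mx_sqr : flip_mx *m flip_mx = 1%:M.
Proof.
rewrite mulmx_block !mulmx0 !mul0mx mulmx1 mulmxN mulNmx opprK mulmx1.
by rewrite !addr0 add0r -scalar_mx_block.
Qed.

(** [flip_mx] is the symmetric Jacobian matrix of the flip, so the hypothesis is invariance of the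
    tensor under push-forward. *)
Lemma flip_p_automorphism (J : 'rV[R]_(N + N) -> 'M[R]_(N + N)) :
  (forall x, J (flip_p x) = flip_mx *m J x *m flip_mx) ->
  poisson_automorphism J (@flip_p R N).
Proof.
move=> JE; split.
  exists (@flip_p R N); split.
  - exact: smooth_map_flip_p.
  - exact: smooth_map_flip_p.
  - exact: flip_p_involutive.
  - exact: flip_p_involutive.
move=> F H sF sH; apply/funext => x; rewrite /= !bracketE JE.
by rewrite (gradient_flip_p x sF) (gradient_flip_p x sH) trmx_mul tr_flip_mx !mulmxA.
Qed.

(** * The fixed point set p = 0 and its inherited bracket *)

Lemma zero_section_linear (h : R) (v x : 'rV[R]_N) :
  zero_section (h *: v + x) = h *: zero_section v + zero_section x.
Proof. by rewrite /zero_section scale_row_mx add_row_mx scaler0 addr0. Qed.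

Lemma zero_section_basis (i : 'I_N) :
  zero_section (delta_mx 0 i) = (1 : R) *: delta_mx 0 (lshift N i).
Proof.
rewrite scale1r; apply/rowP => j; case: (split_ordP j) => k ->.
  by rewrite row_mxEl !mxE eq_lshift.
by rewrite row_mxEr !mxE eq_rlshift andbF.
Qed.

Lemma smooth_map_zero_section : smooth_map (@zero_section R N).
Proof.
move=> i; case: (split_ordP i) => j ->.
  by under eq_fun do rewrite row_mxEl; exact: smooth_coord.
by under eq_fun do rewrite row_mxEr mxE; exact: smooth_cst.
Qed.

Lemma smooth_comp_lsubmx f : smooth f ->
  smooth (f \o (lsubmx : 'rV[R]_(N + N) -> 'rV[R]_N)).
Proof.
(* The projection kills the p-directions: their coefficient is 0, and the index chosen for them is
   arbitrary. *)
apply: (@smooth_comp_monomial _ _ _ _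
  (fun i => if fintype.split i is inl _ then 1 else 0)
  (fun i => match fintype.split i with inl j => j | inr j => j end)).
- by move=> h v x; apply/rowP => j; rewrite !mxE.
- exact: continuous_lsubmx.
- move=> i; case: split_ordP => j ->; apply/rowP => k.
    by rewrite scale1r !mxE eq_lshift.
  by rewrite scale0r !mxE eq_lrshift andbF.
Qed.

Lemma flip_p_zero_section (q : 'rV[R]_N) :
  flip_p (zero_section q) = zero_section q.
Proof. by rewrite /flip_p row_mxKl row_mxKr oppr0. Qed.

Lemma zero_section_embedding :
  fixed_point_embedding (@flip_p R N) (@zero_section R N).
Proof.
split; first exact: smooth_map_zero_section.
  exists lsubmx; split=> [i|q]; last exact: row_mxKl.
  by under eq_fun do rewrite mxE; exact: smooth_coord.
apply/seteqP; split=> [_ [q _ <-]|x /= fx]; first exact: flip_p_zero_section.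
exists (lsubmx x) => //; rewrite -[RHS]hsubmxK; congr row_mx.
have : rsubmx (flip_p x) = rsubmx x by rewrite fx.
rewrite row_mxKr => /rowP E; apply/rowP => i.
(* A fixed point satisfies -p = p, hence 2p = 0. *)
have Ei : - rsubmx x 0 i = rsubmx x 0 i by rewrite -[RHS]E [RHS]mxE.
have : rsubmx x 0 i *+ 2 == 0 by rewrite mulr2n -{1}Ei addNr.
by rewrite [LHS]mxE mulrn_eq0 => /eqP.
Qed.

(* At a fixed point, the p-derivatives of an invariant function are equal to
   their opposites. *)
Lemma gradient_invariant F (q : 'rV[R]_N) : smooth F ->
  F \o @flip_p R N = F ->
  gradient F (zero_section q) = row_mx (gradient (F \o @zero_section R N) q) 0.
Proof.
move=> sF F_inv; apply/rowP => i; rewrite (gradientE F _ i).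
case: (split_ordP i) => j ->.
  rewrite row_mxEl (gradientE _ q j).
  by rewrite (pderiv_comp_monomial zero_section_linear zero_section_basis j q sF) mul1r.
rewrite row_mxEr [RHS]mxE; apply/eqP.
have := pderiv_comp_monomial flip_p_linear flip_p_basis (rshift N j)
  (zero_section q) sF.
rewrite F_inv flip_sign_rshift flip_p_zero_section mulN1r => /eqP.
by rewrite -addr_eq0 -mulr2n mulrn_eq0.
Qed.

(** Gradients of invariant functions have no p-component on p = 0, so only the upper left block
    contributes. *)
Lemma restricts_to_zero_section (J : 'rV[R]_(N + N) -> 'M[R]_(N + N))
    (w : 'rV[R]_N -> 'M[R]_N) :
  (forall q, ulsubmx (J (zero_section q)) = w q) ->
  restricts_to J (@flip_p R N) (@zero_section R N) (bracket w).
Proof.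
move=> Jw F1 F2 s1 s2 i1 i2; apply/funext => q /=.
rewrite !bracketE (gradient_invariant q s1 i1) (gradient_invariant q s2 i2) -Jw.
rewrite -{1}[J (zero_section q)]submxK mul_row_block !mul0mx !addr0.
by rewrite tr_row_mx mul_row_col trmx0 mulmx0 addr0.
Qed.

Lemma flip_p_inherited (J : 'rV[R]_(N + N) -> 'M[R]_(N + N))
    (w : 'rV[R]_N -> 'M[R]_N) :
  is_poisson_bracket (bracket w) ->
  (forall q, ulsubmx (J (zero_section q)) = w q) ->
  inherited_bracket J (@flip_p R N) (@zero_section R N) (bracket w).
Proof.
move=> Pw /restricts_to_zero_section Jw; split.
- exact: zero_section_embedding.
- exact: Pw.
- exact: Jw.
move=> b' _ Jb' f g sf sg.
(* Each f on V_q is the restriction of the invariant function f o [lsubmx], so the restriction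
   property forces the value of any candidate bracket. *)
have lK h : (h \o lsubmx) \o @zero_section R N = h :> ('rV[R]_N -> R).
  by apply/funext => q /=; rewrite row_mxKl.
have inv h : (h \o lsubmx) \o @flip_p R N = h \o lsubmx :> ('rV[R]_(N + N) -> R).
  by apply/funext => x /=; rewrite row_mxKl.
have [sf' sg'] := (smooth_comp_lsubmx sf, smooth_comp_lsubmx sg).
have := Jb' _ _ sf' sg' (inv f) (inv g).
by rewrite (Jw _ _ sf' sg' (inv f) (inv g)) !lK.
Qed.

End flip.

(** * The Toda brackets *)

Lemma sum_mul_delta {R : pzRingType} {I : finType} (F : I -> R) (a : I) :
  \sum_d F d * (d == a)%:R = F a.
Proof.
by rewrite (bigD1 a) //= eqxx mulr1 big1 ?addr0 // => d /negPf ->; rewrite mulr0.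
Qed.

Lemma rotate_sums {V : nmodType} {I : finType} (F : I -> I -> I -> V) :
  \sum_a \sum_b \sum_c F a b c = \sum_c \sum_a \sum_b F a b c.
Proof.
rewrite [RHS]exchange_big; apply: eq_bigr => a _ /=.
by rewrite [RHS]exchange_big.
Qed.

Section toda.
Context {R : realType} {N : nat}.
Implicit Types (q : 'rV[R]_N) (x : 'rV[R]_(N + N)).

Local Notation A := (toda_A R N).
Local Notation C := (@toda_C R N).
Local Notation flip_mx := (@flip_mx R N).

Lemma skew_mx_tr (u : 'I_N -> 'I_N -> R) : (skew_mx u)^T = - skew_mx u.
Proof. by apply/matrixP => i j; rewrite !mxE; case: ltngtP; rewrite ?opprK ?oppr0. Qed.

Lemma smooth_skew_mx {n : nat} (u : 'rV[R]_n -> 'I_N -> 'I_N -> R) i j :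
  (forall k l, smooth (fun y => u y k l)) -> smooth (fun y => skew_mx (u y) i j).
Proof.
move=> su; under eq_fun do rewrite mxE.
case: ltngtP => _; [exact: su| |exact: smooth_cst].
under eq_fun do rewrite -mulN1r.
exact: smoothZ.
Qed.

(** Pairing the entries (i, j) and (j, i) leaves a sum over i < j, here used to write A C A^T in
    terms of 2 x 2 minors of A. *)
Lemma sum_skew_mx (u X : 'I_N -> 'I_N -> R) :
  \sum_i \sum_j skew_mx u i j * X i j =
  \sum_(i < N) \sum_(j < N | (i < j)%N) u i j * (X i j - X j i).
Proof.
transitivity (\sum_(i < N) \sum_(j < N) ((if (i < j)%N then u i j * X i j else 0)
    - (if (j < i)%N then u j i * X i j else 0))).
  apply: eq_bigr => i _; apply: eq_bigr => j _; rewrite mxE.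
  by case: ltngtP; rewrite ?subr0 ?sub0r ?mulNr ?mul0r.
under eq_bigr do rewrite sumrB.
rewrite sumrB (exchange_big _ _ _ _ _ (fun i j : 'I_N => if (j < i)%N then _ else _)) /=.
rewrite -sumrB; apply: eq_bigr => i _; rewrite -sumrB [RHS]big_mkcond.
by apply: eq_bigr => j _; case: ifP; rewrite ?subr0 ?mulrBr.
Qed.

(** The upper triangle of [toda_C]; the adjacency test alone makes it vanish elsewhere, so sums may
    run over all pairs. *)
Definition superdiag q (a b : 'I_N) : R :=
  if a.+1 == b :> nat then expR (q 0 a - q 0 b) else 0.

Lemma toda_AE (i j : 'I_N) : A i j = (i < j)%:R - (j < i)%:R.
Proof. by rewrite mxE; case: ltngtP; rewrite ?subr0 ?sub0r. Qed.

Lemma toda_C_skew q : (C q)^T = - C q.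
Proof. exact: skew_mx_tr. Qed.

Lemma toda_C_swap q i j : C q i j = - C q j i.
Proof. by have /matrixP/(_ j i) := toda_C_skew q; rewrite !mxE. Qed.

Lemma smooth_toda_C i j : smooth (fun q => C q i j).
Proof.
apply: smooth_skew_mx => k l; case: eqP => _; last exact: smooth_cst.
exact: smooth_exp_sub.
Qed.

(** Below the diagonal the entry is -exp(q_j - q_i), with reversed exponent; the factor A_ij
    corrects the sign of the derivative. *)
Lemma pderiv_toda_C l i j q :
  pderiv l (fun y => C y i j) q =
  ((l == i)%:R - (l == j)%:R) * A i j * C q i j.
Proof.
have pderiv_exp a b : pderiv l (fun y : 'rV[R]_N => expR (y 0 a - y 0 b)) q =
    ((l == a)%:R - (l == b)%:R) * expR (q 0 a - q 0 b).
  exact: (@derive_val _ _ _ _ _ _ _ (is_derive_exp_sub a b l q)).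
under eq_fun do rewrite mxE.
rewrite toda_AE [C q i j]mxE; case: ltngtP => ij.
- rewrite subr0 mulr1; case: eqP => _; last by rewrite pderiv_cst mulr0.
  exact: pderiv_exp.
- case: eqP => _; last by rewrite oppr0 pderiv_cst mulr0.
  under eq_fun do rewrite -mulN1r.
  rewrite pderivZ; last exact: smooth_exp_sub.
  by rewrite pderiv_exp mulr1n mulr0n; ring.
- by rewrite pderiv_cst mulr0.
Qed.

(* With pderiv_toda_C, this is the relation D_d C_ab = (d_da + d_db) C_ab. *)
Lemma toda_C_eigen q (a b d : 'I_N) :
  A a b * C q a b * (A a d - A b d) = ((d == a)%:R + (d == b)%:R) * C q a b.
Proof.
rewrite !toda_AE mxE -!val_eqE /=.
(* Only adjacent a, b matter, and no index lies strictly between them: A_ad - A_bd equals A_ab for d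
   = a or d = b and 0 otherwise. *)
by case: (ltngtP a b) => ab; try (case: eqP => [E|_]); try (by rewrite ?oppr0; ring);
  case: (ltngtP d a) => da; case: (ltngtP d b) => db; rewrite /= ; try lia; ring.
Qed.

(** * The identity w_3 = A C A^T *)

Lemma toda_ACA_sum q i j :
  (A *m C q *m A^T) i j =
  \sum_a \sum_b superdiag q a b * (A i a * A j b - A i b * A j a).
Proof.
rewrite mulmx_trE; under eq_bigr do under eq_bigr do rewrite -mulrA.
rewrite sum_skew_mx; apply: eq_bigr => a _; rewrite big_mkcond.
apply: eq_bigr => b _; rewrite /superdiag [b == _ :> nat]eq_sym.
by case: eqP => [<-|_]; rewrite ?ltnSn ?mul0r ?if_same.
Qed.

Lemma exp_prev_sum q i :
  exp_prev q i = \sum_a \sum_b superdiag q a b * (b == i)%:R.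
Proof.
under [RHS]eq_bigr do rewrite sum_mul_delta.
by rewrite /exp_prev big_mkcond.
Qed.

Lemma exp_next_sum q i :
  exp_next q i = \sum_a \sum_b superdiag q a b * (a == i)%:R.
Proof.
rewrite exchange_big; under [RHS]eq_bigr do rewrite sum_mul_delta.
by rewrite /exp_next big_mkcond.
Qed.

Lemma w3E q : w3 q = A *m C q *m A^T.
Proof.
(* Coefficients are compared for each edge b = a + 1. If j = i + 1, the edge from i to j occurs in
   both [exp_next q i] and [exp_prev q j]; the Kronecker delta removes the duplicate. *)
have upper (i j : 'I_N) : (i < j)%N -> exp_prev q i
    + (1 - (i.+1 == j :> nat)%:R) * exp_next q i + exp_prev q j + exp_next q j =
    (A *m C q *m A^T) i j.
  move=> ij; rewrite toda_ACA_sum !exp_prev_sum !exp_next_sum.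
  rewrite mulr_sumr -!big_split; apply: eq_bigr => a _ /=.
  rewrite mulr_sumr -!big_split; apply: eq_bigr => b _ /=.
  rewrite /superdiag; case: eqP => [ab|_]; last by rewrite !mul0r mulr0 !addr0.
  rewrite !toda_AE -!val_eqE /=.
  by case: (ltngtP i a) => ia; case: (ltngtP i b) => ib;
    case: (ltngtP j a) => ja; case: (ltngtP j b) => jb;
    case: eqP => ij1; rewrite ?mulr1n ?mulr0n; try lia; ring.
apply/matrixP => i j; rewrite mxE; case: ltngtP => [ij|ij|/val_inj <-].
- exact: upper.
- rewrite upper // !toda_ACA_sum -sumrN; apply: eq_bigr => a _.
  by rewrite -sumrN; apply: eq_bigr => b _; ring.
- rewrite toda_ACA_sum big1 // => a _; rewrite big1 // => b _; ring.
Qed.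

(** * Poisson property of w_3 and w_2 *)

Lemma w3_skew q : (w3 q)^T = - w3 q.
Proof. exact: skew_mx_tr. Qed.

Lemma w3_sum q i j : w3 q i j = \sum_a \sum_b C q a b * A i a * A j b.
Proof. by rewrite w3E mulmx_trE. Qed.

Lemma smooth_w3 i j : smooth (fun q => w3 q i j).
Proof.
under eq_fun do rewrite w3_sum.
apply: smooth_sum => a _; apply: smooth_sum => b _.
by do 2![apply: smoothM; last exact: smooth_cst]; exact: smooth_toda_C.
Qed.

Lemma pderiv_w3 l i j q :
  pderiv l (fun y => w3 y i j) q =
  \sum_a \sum_b A i a * A j b * (((l == a)%:R - (l == b)%:R) * A a b * C q a b).
Proof.
have sA a b : smooth (fun y => A i a * A j b * C y a b).
  exact/smoothZ/smooth_toda_C.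
under eq_fun do rewrite w3_sum.
transitivity (pderiv l (fun y => \sum_a \sum_b A i a * A j b * C y a b) q).
  congr (pderiv l _ q); apply/funext => y.
  by apply: eq_bigr => a _; apply: eq_bigr => b _; ring.
rewrite pderiv_sum => [|a]; last by apply: smooth_sum.
apply: eq_bigr => a _; rewrite pderiv_sum //; apply: eq_bigr => b _.
by rewrite pderivZ ?pderiv_toda_C //; exact: smooth_toda_C.
Qed.

Lemma w3_jacobi_term q i j k :
  \sum_l w3 q i l * pderiv l (fun y => w3 y j k) q =
  \sum_c \sum_a \sum_b
    A i c * A j a * A k b * ((C q c a + C q c b) * C q a b).
Proof.
(* Expanding w_3 = A C A^T produces A_ad - A_bd, which [toda_C_eigen] turns into Kronecker deltas
   that collapse the sum over d. *)
have diff a b : (w3 q i a - w3 q i b) * (A a b * C q a b) =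
    \sum_c A i c * ((C q c a + C q c b) * C q a b).
  rewrite !w3_sum -sumrB mulr_suml; apply: eq_bigr => c _.
  rewrite -sumrB mulr_suml.
  transitivity (A i c * (\sum_d C q c d * (((d == a)%:R + (d == b)%:R) * C q a b))).
    rewrite mulr_sumr; apply: eq_bigr => d _.
    by rewrite -toda_C_eigen; ring.
  congr (_ * _); under eq_bigr do rewrite mulrA.
  rewrite -mulr_suml; congr (_ * _).
  under eq_bigr do rewrite mulrDr; rewrite big_split /=.
  by rewrite !sum_mul_delta.
transitivity (\sum_a \sum_b A j a * A k b *
    ((w3 q i a - w3 q i b) * (A a b * C q a b))).
  under eq_bigr do rewrite pderiv_w3 mulr_sumr.
  rewrite exchange_big; apply: eq_bigr => a _.
  under eq_bigr do rewrite mulr_sumr.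
  rewrite exchange_big; apply: eq_bigr => b _.
  transitivity (A j a * A k b * ((\sum_l w3 q i l * ((l == a)%:R - (l == b)%:R))
      * (A a b * C q a b))).
    by rewrite mulr_suml mulr_sumr; apply: eq_bigr => l _; ring.
  congr (_ * (_ * _)); under eq_bigr do rewrite mulrBr; rewrite sumrB.
  by rewrite !sum_mul_delta.
rewrite [RHS]exchange_big; apply: eq_bigr => a _ /=.
rewrite [RHS]exchange_big; apply: eq_bigr => b _ /=.
by rewrite diff mulr_sumr; apply: eq_bigr => c _; ring.
Qed.

Lemma w3_is_poisson : is_poisson_bracket (bracket (@w3 R N)).
Proof.
apply: bracket_is_poisson; [exact: smooth_w3|exact: w3_skew|move=> q i j k].
(* The summation indices are rotated so that all three terms carry the weight A_ic A_ja A_kb; the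
   remaining cubic expression vanishes by skewness of C. *)
rewrite !w3_jacobi_term [X in _ + X + _]rotate_sums.
rewrite -[X in _ + _ + X]rotate_sums -!big_split big1 //= => c _.
rewrite -!big_split big1 //= => a _; rewrite -!big_split big1 //= => b _.
rewrite (toda_C_swap q b a) (toda_C_swap q c b) (toda_C_swap q a c).
by ring.
Qed.

Lemma w2_is_poisson : is_poisson_bracket (bracket (@w2 R N)).
Proof.
have sw2 i j : smooth (fun q => w2 q i j) by exact: smooth_cst.
apply: bracket_is_poisson => // [q|q i j k]; first exact: skew_mx_tr.
have dw2 a b c : \sum_l w2 q a l * pderiv l (fun y => w2 y b c) q = 0 :> R.
  by apply: big1 => l _; rewrite /w2 pderiv_cst mulr0.
by rewrite !dw2 !addr0.
Qed.

(** * The Toda tensors under the flip and on p = 0 *)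

Lemma invmx_toda_J1 : invmx (toda_J1 R N) = - toda_J1 R N.
Proof.
have J1K : toda_J1 R N *m (- toda_J1 R N) = 1%:M.
  rewrite mulmxN mulmx_block !mulmx0 !mul0mx !mulmx1 !mul1mx !addr0 !add0r.
  by rewrite opp_block_mx oppr0 opprK -scalar_mx_block.
have [J1U _] := mulmx1_unit J1K.
by rewrite -[RHS](mulKmx J1U) J1K mulmx1.
Qed.

Lemma toda_J1_flip : flip_mx *m toda_J1 R N *m flip_mx = - toda_J1 R N.
Proof.
rewrite !mulmx_block opp_block_mx.
by rewrite !(mul0mx, mulmx0, mulmxN, mulNmx, mulmx1, oppr0, addr0, add0r, opprK).
Qed.

Lemma toda_J2_flip x : toda_J2 (flip_p x) = flip_mx *m toda_J2 x *m flip_mx.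
Proof.
rewrite /toda_J2 /toda_B row_mxKl row_mxKr !mulmx_block.
rewrite !(mulmx0, mul0mx, mulmxN, mulNmx, mulmx1, mul1mx, addr0, add0r, opprK).
by rewrite [diag_mx (- _)]linearN opprK.
Qed.

(** The sign is that of J_1, which the flip reverses while preserving J_2. It disappears in J_4,
    where the recursion operator occurs twice. *)
Lemma toda_recursion_flip x :
  toda_recursion (flip_p x) = - (flip_mx *m toda_recursion x *m flip_mx).
Proof.
rewrite /toda_recursion invmx_toda_J1 toda_J2_flip -{1}toda_J1_flip.
rewrite !mulmxN !mulNmx opprK !mulmxA -(mulmxA _ flip_mx flip_mx) flip_mx_sqr.
by rewrite mulmx1.
Qed.

Lemma toda_J4_flip x : toda_J4 (flip_p x) = flip_mx *m toda_J4 x *m flip_mx.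
Proof.
rewrite /toda_J4 toda_recursion_flip toda_J2_flip mulNmx mulmxN opprK.
rewrite !mulmxA -(mulmxA _ flip_mx flip_mx) flip_mx_sqr mulmx1.
by rewrite -(mulmxA _ flip_mx flip_mx) flip_mx_sqr mulmx1.
Qed.

Lemma toda_J2_zero_section q : ulsubmx (toda_J2 (zero_section q)) = w2 q.
Proof. exact: block_mxKul. Qed.

(** On p = 0 one has J_2 = diag(A, C), and R has off-diagonal blocks -A and C. Hence R^2 J_2 has
    upper left block -A C A = A C A^T. *)
Lemma toda_J4_zero_section q : ulsubmx (toda_J4 (zero_section q)) = w3 q.
Proof.
rewrite /toda_J4 /toda_recursion invmx_toda_J1 /toda_J2 /toda_B /toda_J1.
rewrite row_mxKl row_mxKr oppr0 linear0 opp_block_mx !mulmx_block.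
rewrite !(mulmx0, mul0mx, mulmxN, mulNmx, mulmx1, mul1mx, addr0, add0r, opprK, oppr0).
by rewrite block_mxKul w3E skew_mx_tr mulmxN.
Qed.

End toda.

Theorem mainTheorem2 (R : realType) (N : nat) (N_ge2 : (2 <= N)%N)
    (N_even : ~~ odd N) :
  involutive (@flip_p R N) /\
  poisson_automorphism (@toda_J2 R N) (@flip_p R N) /\
  poisson_automorphism (@toda_J4 R N) (@flip_p R N) /\
  inherited_bracket (@toda_J2 R N) (@flip_p R N) (@zero_section R N)
    (bracket (@w2 R N)) /\
  inherited_bracket (@toda_J4 R N) (@flip_p R N) (@zero_section R N)
    (bracket (@w3 R N)).
Proof.
split; first exact: flip_p_involutive.
split; first exact/flip_p_automorphism/toda_J2_flip.
split; first exact/flip_p_automorphism/toda_J4_flip.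
split; first exact: flip_p_inherited w2_is_poisson toda_J2_zero_section.
exact: flip_p_inherited w3_is_poisson toda_J4_zero_section.
Qed.
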